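(* Let $p$ be a prime and let $G^+$ be a finite $p$-group. Then $G^+$ satisfies property $\mathcal P^+(p)$ if and only if there exists $x\in G^+$ such that the subgroup $\langle x^p\rangle$ is not normal in $G^+$.
   Context: For a finite group $\Gamma$, $\ell\ge1$ and $x\in\Gamma$, $r_\ell(x)=|\{g\in\Gamma:g^\ell=x\}|$. A subgroup $G$ satisfies $\mathcal P(p)$ relative to $(a,b)$ if $a,b\in G$ have the same order, $0=r_p(a)<r_p(b)$ (roots counted in $G$), and $r_\ell(a)=r_\ell(b)$ for every square-free integer $1<\ell<p$. $G^+$ satisfies $\mathcal P^+(p)$ if there exist $a,b\in G^+$ conjugate in $G^+$ and a subgroup $G\subset G^+$ containing $a,b$ such that $G$ satisfies $\mathcal P(p)$ relative to $(a,b)$. *)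

(* Defs.v *)
From mathcomp Require Import all_boot all_fingroup all_solvable.

Set Implicit Arguments.
Unset Strict Implicit.
Unset Printing Implicit Defensive.

Local Open Scope group_scope.

Definition squarefree (n : nat) : Prop :=
  0 < n /\ forall d : nat, d ^ 2 %| n -> d = 1%N.

(* The roots are counted in [G], not in the ambient type [gT]. *)
Definition nroots (gT : finGroupType) (G : {group gT}) (l : nat) (x : gT) : nat :=
  #|[set g in G | g ^+ l == x]|.

Definition propP (gT : finGroupType) (p : nat) (G : {group gT}) (a b : gT) : Prop :=
  [/\ a \in G /\ b \in G,
      #[a] = #[b],
      0%N = nroots G p a,
      nroots G p a < nroots G p b
    & forall l : nat, squarefree l -> 1 < l -> l < p ->
        nroots G l a = nroots G l b].

Definition propPplus (gT : finGroupType) (p : nat) (Gp : {group gT}) : Prop :=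
  exists a b : gT,
    [/\ a \in Gp, b \in Gp,
        exists2 g, g \in Gp & b = a ^ g
      & exists G : {group gT},
          [/\ G \subset Gp, a \in G, b \in G & propP p G a b]].

(* Main.v *)
Require Import Defs.
From mathcomp Require Import all_boot all_fingroup all_solvable.

(** If [<[x ^+ p]>] is not normal, pick a conjugate [a] of [b = x ^+ p] outside
    [<[b]>] and let [G = <x, a>].  A [p]-th root of [a] in [G] would put [a] in the
    Frattini subgroup of [G], so [G = <x>] would be cyclic and its subgroups
    [<a>] and [<b>] of equal order would coincide.  For [l < p], the [l]-th power
    map permutes the [p]-group [G], so every element has exactly one [l]-th root.
    Conversely, if [<[y ^+ p]>] is normal then every conjugate of [y ^+ p] is
    [(y ^+ k) ^+ p] for some [k], hence a [p]-th power in any subgroup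
    containing [y]. *)

Local Open Scope group_scope.

(** Raising to the inverse of [l] modulo [#|G|] undoes the [l]-th power map on [G]. *)
Lemma nroots_coprime {gT : finGroupType} {G : {group gT}} {l : nat} {a : gT} :
  coprime #|G| l -> a \in G -> nroots G l a = 1%N.
Proof.
move=> coGl aG; apply/eqP/cards1P; exists (a ^+ expg_invn G l).
apply/setP => g; rewrite !inE; apply/andP/eqP => [[gG /eqP <-] | ->].
  by rewrite expgK.
by rewrite groupX // -expgM mulnC expgM expgK.
Qed.

Lemma nroots_gt0 {gT : finGroupType} {G : {group gT}} {l : nat} {a : gT} :
  reflect (exists2 g, g \in G & g ^+ l = a) (0 < nroots G l a).
Proof.
apply: (iffP card_gt0P) => [[g] | [g gG ga]].
  by rewrite inE => /andP[gG /eqP]; exists g.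
by exists g; rewrite inE gG ga eqxx.
Qed.

(** In a [p]-group, ['Phi(G)] is the join of the derived subgroup and ['Mho^1(G)], the latter
    containing all [p]-th powers. *)
Lemma expg_Phi {gT : finGroupType} {p : nat} {G : {group gT}} {y : gT} :
  p.-group G -> y \in G -> y ^+ p \in 'Phi(G).
Proof.
move=> pG yG; rewrite (Phi_joing pG) mem_gen // inE; apply/orP; right.
by rewrite -[p in y ^+ p]expn1 Mho_p_elt ?(mem_p_elt pG).
Qed.

Lemma nroots_join_cycle {gT : finGroupType} {p : nat} {x a : gT} :
  p.-group (<[x]> <*> <[a]>) -> #[a] = #[x ^+ p] -> a \notin <[x ^+ p]> ->
  nroots (<[x]> <*> <[a]>)%G p a = 0%N.
Proof.
move=> pG oab nab; apply/eqP; rewrite -leqn0 leqNgt.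
apply: contra nab => /nroots_gt0[y yG ya].
have aPhi: a \in 'Phi(<[x]> <*> <[a]>).
  by have := expg_Phi pG yG; rewrite ya.
have xG: << <[x]> >> = <[x]> <*> <[a]>.
  apply: (@Phi_nongen _ (<[x]> <*> <[a]>)%G); apply/eqP.
  rewrite eqEsubset join_subG Phi_sub joing_subl join_subG joing_subr /=.
  by rewrite (subset_trans _ (joing_subl _ _)) // cycle_subG.
rewrite genGid in xG.
have ax: <[a]> \subset <[x]> by rewrite xG joing_subr.
have /eqP <- : <[a]> == <[x ^+ p]>.
  by rewrite (eq_subG_cyclic (cycle_cyclic x)) ?cycleX // -!orderE oab.
exact: cycle_id.
Qed.

Theorem theorem4p11 (gT : finGroupType) (p : nat) (Gp : {group gT}) :
  prime p -> p.-group Gp ->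
  propPplus p Gp <-> exists2 x : gT, x \in Gp & ~~ (<[x ^+ p]> <| Gp).
Proof.
move=> p_pr pGp; split.
  case=> a [b [_ _ [g gGp bE] [G [sGGp _ _ [_ _ a0 ab _]]]]].
  move: ab; rewrite -a0 => /nroots_gt0[y yG yb].
  exists y; first exact: (subsetP sGGp).
  apply/negP => /andP[_ nb].
  suff: 0 < nroots G p a by rewrite -a0.
  have: a \in <[y ^+ p]>.
    (* As [g] normalizes [<[y ^+ p]>], it suffices that [a ^ g = b = y ^+ p] lies there. *)
    have /memJ_norm <- : g \in 'N(<[y ^+ p]>) by apply: (subsetP nb).
    by rewrite -bE yb cycle_id.
  case/cycleP=> k ->; apply/nroots_gt0; exists (y ^+ k); first exact: groupX.
  by rewrite -!expgM mulnC.
case=> x xGp; rewrite /normal cycle_subG groupX //= => /subsetPn[g gGp].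
rewrite inE -cycleJ cycle_subG => nab.
set a := (x ^+ p) ^ g in nab.
have aGp: a \in Gp by rewrite groupJ ?groupX.
have sG: <[x]> <*> <[a]> \subset Gp by rewrite join_subG !cycle_subG xGp.
have pG := pgroupS sG pGp.
have xG: x \in <[x]> <*> <[a]> by rewrite mem_gen // inE cycle_id.
have aG: a \in <[x]> <*> <[a]> by rewrite mem_gen // inE cycle_id orbT.
have bG: x ^+ p \in <[x]> <*> <[a]> by rewrite groupX.
have oab: #[a] = #[x ^+ p] by rewrite orderJ.
have r0 := nroots_join_cycle pG oab nab.
exists a, (x ^+ p); split=> //; first exact: groupX.
  (* The conjugation must lead from the rootless [a] back to [x ^+ p]. *)
  by exists g^-1; rewrite ?groupV // /a conjgK.
exists (<[x]> <*> <[a]>)%G; split=> //; split=> //.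
  by rewrite r0; apply/nroots_gt0; exists x.
move=> l _ l_gt1 l_ltp.
have coGl: coprime #|<[x]> <*> <[a]>| l.
  apply: (pnat_coprime pG); rewrite p'natE // gtnNdvd //.
  exact: ltnW.
by rewrite !nroots_coprime.
Qed.
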